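(* For non-negative integers $v,h$ and an integer $a$, let $\mathbb{Y}_{v+1,h+1,a}$ be the set of shortest lattice paths from $(0,0)$ to $(h+1,v+1)$ such that the number of cells on the upper-left side of the path is congruent to $a$ modulo $v+h+2$. For $\mathbf{y}\in\mathbb{Y}_{v+1,h+1,a}$ let $\mathrm{dS}_{PATH}(\mathbf{y})$ denote the set of paths in $\mathbb{Y}_{v,h}$ obtained as follows: if $\mathbf{y}$ begins with a horizontal step $y_1$, delete $y_1$ and some vertical step $y_j$; if $\mathbf{y}$ begins with a vertical step $y_1$, delete $y_1$ and some horizontal step $y_j$. Then $\{\mathrm{dS}_{PATH}(\mathbf{y})\mid\mathbf{y}\in\mathbb{Y}_{v+1,h+1,a}\}$ is a partition of $\mathbb{Y}_{v,h}$; that is, the sets $\mathrm{dS}_{PATH}(\mathbf{y})$ for different $\mathbf{y}\in\mathbb{Y}_{v+1,h+1,a}$ are disjoint and their union is $\mathbb{Y}_{v,h}$.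
   Context: $\mathbb{Y}_{v,h}$ is the set of bit sequences in $\{0,1\}^{v+h}$ with exactly $v$ zeros and $h$ ones. Such a sequence is identified with a shortest lattice path (unit steps right and up) from $(0,0)$ to $(h,v)$ by reading $0$ as a vertical (up) step and $1$ as a horizontal (right) step. The cells on the upper-left side of the path are the unit cells of the rectangle $[0,h]\times[0,v]$ lying above and to the left of the path; their number equals $\mathrm{inv}(\mathbf{x})=\#\{(i,j)\mid i<j,\ x_i>x_j\}$ for the corresponding bit sequence $\mathbf{x}$. All possible choices of the second deleted step $y_j$ are allowed; deleting two steps means removing them from the sequence and concatenating the rest. *)

(* Defs.v *)
From mathcomp Require Import all_boot all_order all_algebra.

Set Implicit Arguments.
Unset Strict Implicit.
Unset Printing Implicit Defensive.

(* A lattice path is the sequence of its steps: [false] (the bit 0) is a unit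
   step up and [true] (the bit 1) is a unit step to the right. *)
Definition vertical (b : bool) : bool := b == false.
Definition horizontal (b : bool) : bool := b == true.

Definition lattice_paths (v h : nat) : {set (v + h).-tuple bool} :=
  [set x : (v + h).-tuple bool | (count vertical x == v) && (count horizontal x == h)].

(* The path [x] visits the points [(abscissa x k, ordinate x k)], 0 <= k <= size x. *)
Definition abscissa (x : seq bool) (k : nat) : nat := count horizontal (take k x).
Definition ordinate (x : seq bool) (k : nat) : nat := count vertical (take k x).

(* The pair [(i, j)] stands for the unit cell [i, i+1] x [j, j+1] of the
   rectangle [0, h] x [0, v].  It lies on the upper-left side of the path iff
   its lower-right corner (i+1, j) is weakly to the left of and above some
   point of the path. *)
Definition upper_left_cells (v h : nat) (x : (v + h).-tuple bool) :
    {set 'I_h * 'I_v} :=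
  [set c : 'I_h * 'I_v | [exists k : 'I_(v + h).+1,
     (c.1.+1 <= abscissa x k) && (ordinate x k <= c.2)]].

Definition lattice_paths_mod (v h m : nat) (a : int) :
    {set (v + h).-tuple bool} :=
  [set x in lattice_paths v h | (#|upper_left_cells x|%:Z == a %[mod m%:Z])%Z].

Definition delete_step (j : nat) (y : seq bool) : seq bool :=
  take j y ++ drop j.+1 y.

(* The step [y_j] has the type opposite to that of the first step, so j is not
   the first position and [behead] still removes the first step of [y].
   Membership of the results in [lattice_paths v h] is not imposed here. *)
Definition dS_path (v h : nat) (y : (v.+1 + h.+1).-tuple bool) :
    {set (v + h).-tuple bool} :=
  [set x : (v + h).-tuple bool | [exists j : 'I_(v.+1 + h.+1),
     (if horizontal (tnth y ord0) then vertical (tnth y j)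
      else horizontal (tnth y j))
     && (tval x == behead (delete_step j y))]].

(* Main.v *)
Require Import Defs.
From mathcomp Require Import all_boot all_order all_algebra.
From mathcomp Require Import zify.

Set Implicit Arguments.
Unset Strict Implicit.
Unset Printing Implicit Defensive.

(** The number of upper-left cells of a path is its inversion number.  The
    paths [y] with [x] in [dS_path y] arise from [x] by prepending a step [b] and
    inserting one step [~~ b].  This increases the inversion number by the number
    of verticals after the insertion point if [b] is vertical, and by [v + 1] plus
    the number of horizontals before it if [b] is horizontal.  The increments thus
    take each value [0, ..., v] and [v + 1, ..., v + h + 1] for exactly one [y],
    so exactly one [y] meets a given residue modulo [v + h + 2]. *)

(** * Upper-left cells and inversions *)

Fixpoint inversions (s : seq bool) : nat :=
  if s is b :: t then b * count_mem false t + inversions t else 0.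

Definition insert_step (p : nat) (b : bool) (s : seq bool) : seq bool :=
  take p s ++ b :: drop p s.

(** Cells with plain natural coordinates and no enclosing rectangle, so that induction on the path
    can shift them freely. *)
Definition on_upper_left (s : seq bool) (i j : nat) : bool :=
  has (fun k => (i < abscissa s k) && (ordinate s k <= j)) (iota 0 (size s).+1).

(** Dropping the first step moves the origin. A horizontal step has all of column 0 above it; a
    vertical one leaves all of row 0 to its right. *)
Lemma on_upper_left_cons b s i j :
  on_upper_left (b :: s) i j =
  if b then (if i is i'.+1 then on_upper_left s i' j else true)
  else (if j is j'.+1 then on_upper_left s i j' else false).
Proof.
rewrite /on_upper_left.
have -> : iota 0 (size (b :: s)).+1 = 0 :: map S (iota 0 (size s).+1).
  by rewrite -[LHS]/(0 :: iota (1 + 0) (size s).+1) iotaDl.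
have l0 : 0 \in iota 0 (size s).+1 by rewrite mem_iota.
move: (iota _ _) l0 => l l0; rewrite /= has_map /=.
case: b => /=.
  case: i => [|i]; last exact: eq_has.
  by apply/hasP; exists 0; rewrite //= /abscissa /ordinate /= take0.
case: j => [|j]; last exact: eq_has.
by apply/hasP => -[k _] /=; rewrite andbF.
Qed.

Lemma sum_on_upper_left s :
  \sum_(i < count_mem true s) \sum_(j < count_mem false s) on_upper_left s i j
  = inversions s.
Proof.
elim: s => [|b s IHs]; first by rewrite big_ord0.
case: b => /=; rewrite ?add0n ?add1n.
  rewrite big_ord_recl mul1n -IHs; congr (_ + _).
    under eq_bigr do rewrite on_upper_left_cons.
    by rewrite sum1_card card_ord.
  apply: eq_bigr => i _; apply: eq_bigr => j _.
  by rewrite on_upper_left_cons.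
rewrite -IHs; apply: eq_bigr => i _.
rewrite big_ord_recl on_upper_left_cons add0n.
by apply: eq_bigr => j _; rewrite on_upper_left_cons.
Qed.

Lemma lattice_pathsE v h (x : (v + h).-tuple bool) :
  (x \in lattice_paths v h) = (count_mem false x == v) && (count_mem true x == h).
Proof. by rewrite inE. Qed.

Lemma card_upper_left_cells v h (x : (v + h).-tuple bool) :
  x \in lattice_paths v h -> #|upper_left_cells x| = inversions x.
Proof.
rewrite lattice_pathsE => /andP[/eqP xv /eqP xh].
rewrite -sum_on_upper_left xv xh pair_big /= -sum1_card big_mkcond /=.
apply: eq_bigr => -[i j] _; rewrite inE /=.
suff -> : on_upper_left x i j = [exists k : 'I_(v + h).+1,
   (i < abscissa x k) && (ordinate x k <= j)] by case: ifP.
rewrite /on_upper_left size_tuple; apply/hasP/existsP => -[k].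
  by rewrite mem_iota => ltk; exists (Ordinal ltk).
by exists (k : nat) => //; rewrite mem_iota ltn_ord.
Qed.

(** * Inserting one step *)

Lemma count_insert_step a p b s :
  count a (insert_step p b s) = a b + count a s.
Proof.
rewrite /insert_step count_cat /= -{3}(cat_take_drop p s) count_cat; lia.
Qed.

Lemma size_insert_step p b s : size (insert_step p b s) = (size s).+1.
Proof. by rewrite -!count_predT count_insert_step. Qed.

(** An inserted 1 is inverted with each later 0, an inserted 0 with each earlier 1. *)
Lemma inversions_insert_step p b s :
  inversions (insert_step p b s) = inversions s +
  if b then count_mem false (drop p s) else count_mem true (take p s).
Proof.
elim: s p => [|c s IHs] [|p]; first by case: b.
- by case: b.
- by clear IHs; case: b => /=; lia.
rewrite -[insert_step _ _ _]/(c :: insert_step p b s) /= IHs count_insert_step.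
by clear IHs; case: b; case: c => /=; lia.
Qed.

(** Equal counts mean that only steps [b] lie between the two positions, and moving a [b] along a
    run of [b] changes nothing. *)
Lemma insert_step_inj b p q s :
  count_mem (~~ b) (take p s) = count_mem (~~ b) (take q s) ->
  insert_step p b s = insert_step q b s.
Proof.
elim: s p q => [|c s IHs] [|p] [|q] //.
- have := IHs 0 q; rewrite /insert_step take0 drop0 /=.
  case: eqVneq => // cb eq_q /eq_q <-.
  by clear IHs eq_q; case: b c cb => -[].
- have := IHs p 0; rewrite /insert_step take0 drop0 /=.
  case: eqVneq => // cb eq_p /eq_p ->.
  by clear IHs eq_p; case: b c cb => -[].
- by move=> /= /addnI /IHs; rewrite /insert_step /= => ->.
Qed.

Lemma count_mem_take_surj (b : bool) (s : seq bool) m :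
  m <= count_mem b s -> exists2 p, p <= size s & count_mem b (take p s) = m.
Proof.
elim: s m => [|c s IHs] [|m] //=; [by exists 0 | by exists 0|].
case: (eqVneq c b) => [->|ncb] lem.
  by have [p ? <-] := IHs m lem; exists p.+1; rewrite //= eqxx.
by have [p ? <-] := IHs m.+1 lem; exists p.+1; rewrite //= (negbTE ncb).
Qed.

(** * Reversing the deletion *)

Definition extend_path (b : bool) (p : nat) (s : seq bool) : seq bool :=
  b :: insert_step p (~~ b) s.

(** The step inserted at [p] in [x] is the step deleted at [j = p.+1] in [y], the shift being due to
    the prepended step. *)
Lemma dS_pathP v h (y : (v.+1 + h.+1).-tuple bool) (x : (v + h).-tuple bool) :
  reflect (exists b p, p <= size x /\ tval y = extend_path b p x)
          (x \in dS_path y).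
Proof.
have szx := size_tuple x; have szy := size_tuple y.
rewrite inE !(tnth_nth false) /=.
apply: (iffP existsP) => [[[j ltj] /andP[]]|[b [p [lep yE]]]].
  rewrite (tnth_nth false) /=; move: ltj; rewrite -{1}szy.
  case: (tval y) szy => [|b s] // szs ltj yj /eqP xE.
  exists b; case: j ltj yj xE => [|p] /= ltp yp xE.
    (* The first step is not opposite to itself, so [j] is positive. *)
    by move: yp; clear xE szs; case: b.
  exists p; split; first by rewrite szx; move: szs => /=; lia.
  have sp : nth false s p = ~~ b.
    by move: yp; rewrite /horizontal /vertical; case: b {szs}; case: nth.
  rewrite /extend_path /insert_step xE.
  have szp : size (take p s) = p by rewrite size_takel // ltnW.
  by rewrite -{1}szp take_size_cat // drop_size_cat // -sp -drop_nth ?cat_take_drop.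
have ltp : p.+1 < v.+1 + h.+1 by move: lep; rewrite szx; lia.
exists (Ordinal ltp); rewrite (tnth_nth false) /= yE /=.
have szp : size (take p x) = p by rewrite size_takel.
rewrite /insert_step nth_cat szp ltnn subnn /delete_step /= take_size_cat //.
rewrite -cat1s catA drop_size_cat ?size_cat ?szp ?addn1 // cat_take_drop eqxx.
by case: b {yE}.
Qed.

Lemma extend_path_lattice v h b p (y : (v.+1 + h.+1).-tuple bool)
    (x : (v + h).-tuple bool) :
  tval y = extend_path b p x ->
  (y \in lattice_paths v.+1 h.+1) = (x \in lattice_paths v h).
Proof.
rewrite !lattice_pathsE => -> /=; rewrite !count_insert_step.
by case: b => /=; rewrite ?add0n ?add1n ?eqSS.
Qed.

Definition increment (b : bool) (p : nat) (s : seq bool) : nat :=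
  if b then (count_mem false s).+1 + count_mem true (take p s)
  else count_mem false (drop p s).

(** For a horizontal [b], the successor in [increment] counts the inversion between the two added
    steps. *)
Lemma inversions_extend_path b p s :
  inversions (extend_path b p s) = inversions s + increment b p s.
Proof.
rewrite /= inversions_insert_step count_insert_step.
by case: b => /=; lia.
Qed.

Lemma count_mem_take_drop (c : bool) p (s : seq bool) :
  count_mem c (take p s) + count_mem c (drop p s) = count_mem c s.
Proof. by rewrite -count_cat cat_take_drop. Qed.

Lemma size_count_bool (s : seq bool) :
  size s = count_mem false s + count_mem true s.
Proof. by elim: s => [|[] s] //= ->; lia. Qed.

Lemma increment_bound b p s : increment b p s < size s + 2.
Proof.
have := count_mem_take_drop true p s.
have := count_mem_take_drop false p s.
by rewrite /increment size_count_bool; case: b; lia.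
Qed.

Lemma increment_inj b c p q s :
  increment b p s = increment c q s -> extend_path b p s = extend_path c q s.
Proof.
have eqp := count_mem_take_drop false p s.
have eqq := count_mem_take_drop false q s.
(* Increments for vertical [b] are at most the number of zeros of [s], those for horizontal [b]
   exceed it, so the mixed cases are impossible. *)
rewrite /increment /extend_path; case: b c => -[] eq_pq; try by exfalso; lia.
  by congr (_ :: _); apply: insert_step_inj; apply: addnI eq_pq.
have {}eq_pq : count_mem false (take p s) = count_mem false (take q s) by lia.
by congr (_ :: _); apply: insert_step_inj.
Qed.

Lemma increment_surj s r :
  r < size s + 2 -> exists b p, p <= size s /\ increment b p s = r.
Proof.
rewrite {1}size_count_bool => ltr.
have [ler|gtr] := leqP r (count_mem false s).
  (* Cut so that exactly [r] zeros remain after position [p]. *)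
  have [p lep eqp] := @count_mem_take_surj false s _ (leq_subr r _).
  exists false, p; split=> //; rewrite /increment.
  by have := count_mem_take_drop false p s; lia.
have [|p lep eqp] := @count_mem_take_surj true s (r - (count_mem false s).+1).
  lia.
by exists true, p; split=> //; rewrite /increment; lia.
Qed.

(** * Residues and the partition *)

Lemma lattice_paths_modE v h m a (y : (v + h).-tuple bool) :
  (y \in lattice_paths_mod v h m a) = (y \in lattice_paths v h) &&
  ((inversions y)%:Z == a %[mod m%:Z])%Z.
Proof. by rewrite inE; case: (boolP (y \in _)) => //= /card_upper_left_cells ->. Qed.

Lemma dS_path_inj v h a (x : (v + h).-tuple bool)
    (y z : (v.+1 + h.+1).-tuple bool) :
  y \in lattice_paths_mod v.+1 h.+1 (v + h + 2) a ->
  z \in lattice_paths_mod v.+1 h.+1 (v + h + 2) a ->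
  x \in dS_path y -> x \in dS_path z -> y = z.
Proof.
rewrite !lattice_paths_modE => /andP[_ /eqP ya] /andP[_ /eqP za].
move=> /dS_pathP[b [p [_ yE]]] /dS_pathP[c [q [_ zE]]].
apply: val_inj; rewrite /= yE zE; apply: increment_inj.
(* The inversions of [x] cancel; the two increments are congruent and both below the modulus, hence
   equal. *)
move: ya; rewrite -za yE zE !inversions_extend_path !modz_nat.
move=> [] /eqP; rewrite eqn_modDl => /eqP.
by rewrite !modn_small // -{2}(size_tuple x) increment_bound.
Qed.

Lemma dS_path_cover v h a (x : (v + h).-tuple bool) :
  x \in lattice_paths v h ->
  exists2 y, y \in lattice_paths_mod v.+1 h.+1 (v + h + 2) a & x \in dS_path y.
Proof.
move=> xP; have szx := size_tuple x.
set m := v + h + 2; have m_gt0 : (0 < m%:Z)%R by lia.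
(* The increment that carries [x] to the residue of [a]. *)
set r := ((a - (inversions x)%:Z) %% m%:Z)%Z.
have r_ge0 : (0 <= r)%R by rewrite modz_ge0; lia.
have r_lt : (r < m%:Z)%R by rewrite ltz_pmod.
have [|b [p [lep incE]]] := @increment_surj x `|r|%N; first by rewrite szx -/m; lia.
have szy : size (extend_path b p x) == v.+1 + h.+1.
  by rewrite /= size_insert_step szx; lia.
exists (Tuple szy); last by apply/dS_pathP; exists b, p.
rewrite lattice_paths_modE (@extend_path_lattice _ _ b p _ x) // xP.
rewrite inversions_extend_path incE PoszD gez0_abs // modzDmr.
by apply/eqP; congr (modz _ _); lia.
Qed.

(** A partition has no empty block. Both kinds of step occur in [y], so the first step opposite to
    the initial one can be deleted. *)
Lemma dS_path_neq0 v h (y : (v.+1 + h.+1).-tuple bool) :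
  y \in lattice_paths v.+1 h.+1 -> dS_path y != set0.
Proof.
rewrite lattice_pathsE => /andP[/eqP yv /eqP yh].
have szy := size_tuple y; case yE : (tval y) szy yv yh => [|b s] // szs yv yh.
have : ~~ b \in s.
  by rewrite -has_pred1 has_count; case: b {yE szs} yv yh => /=; lia.
move=> bs; have ltp := bs; rewrite -index_mem in ltp.
set p := index _ s in ltp; have szp : size (take p s) = p by rewrite size_takel // ltnW.
have szx : size (take p s ++ drop p.+1 s) == v + h.
  have [{}szs] : (size s).+1 = (v + h.+1).+1 by exact: szs.
  by rewrite size_cat szp size_drop szs; move: ltp; rewrite szs; lia.
apply/set0Pn; exists (Tuple szx); apply/dS_pathP; exists b, p.
rewrite yE /extend_path /insert_step /= take_size_cat // drop_size_cat //.
split; first by rewrite size_cat szp leq_addr.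
by rewrite -{1}(nth_index false bs) -drop_nth // cat_take_drop.
Qed.

Theorem theorem8p2 (v h : nat) (a : int) :
  partition [set dS_path y | y in lattice_paths_mod v.+1 h.+1 (v + h + 2) a]
            (lattice_paths v h)
  /\ (forall y z : (v.+1 + h.+1).-tuple bool,
        y \in lattice_paths_mod v.+1 h.+1 (v + h + 2) a ->
        z \in lattice_paths_mod v.+1 h.+1 (v + h + 2) a ->
        y <> z -> [disjoint dS_path y & dS_path z]).
Proof.
(* Disjointness for distinct paths also gives it for distinct blocks, which come from distinct
   paths. *)
have disj y z : y \in lattice_paths_mod v.+1 h.+1 (v + h + 2) a ->
    z \in lattice_paths_mod v.+1 h.+1 (v + h + 2) a ->
    y <> z -> [disjoint dS_path y & dS_path z].
  move=> yP zP neq_yz; apply/pred0P => x /=; apply/negP => /andP[xy xz].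
  exact/neq_yz/(dS_path_inj yP zP xy xz).
split=> //; apply/and3P; split.
- apply/eqP/setP => x; apply/bigcupP/idP => [[_ /imsetP[y yP ->]]|].
    case/dS_pathP => b [p [_ yE]]; rewrite -(extend_path_lattice yE).
    by move: yP; rewrite lattice_paths_modE => /andP[].
  by case/(dS_path_cover a) => y yP xy; exists (dS_path y) => //; apply: imset_f.
- apply/trivIsetP => _ _ /imsetP[y yP ->] /imsetP[z zP ->] neq_yz.
  by apply: disj => // eq_yz; rewrite eq_yz eqxx in neq_yz.
- apply/imsetP => -[y]; rewrite lattice_paths_modE => /andP[yP _] /esym/eqP.
  by rewrite (negbTE (dS_path_neq0 yP)).
Qed.
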